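(* Let $m\ge0$ be an integer and let $\mathcal{M}$, $\mathcal{D}$, $\mathcal{R}$ be the semi-infinite matrices (indexed from $1$) defined in the context, with $\mathcal{M}=\mathcal{R}^\top\mathcal{R}$ the Cholesky factorization. 1. The Cholesky factor $\mathcal{R}$ is upper triangular with only nonzero entries $\mathcal{R}_{n,n}=c_n$ and $\mathcal{R}_{n,n+2}=d_n$, $n\ge1$, where $$c_n = \sqrt{\dfrac{(n+2m)(n+2m+1)}{(2n+2m-1)(2n+2m+1)}},\qquad d_n = -\sqrt{\dfrac{n(n+1)}{(2n+2m+1)(2n+2m+3)}}.$$ 2. The product $\mathcal{R}\mathcal{R}^\top$ is symmetric with only nonzero entries $(\mathcal{R}\mathcal{R}^\top)_{n,n}=e_n$ and $(\mathcal{R}\mathcal{R}^\top)_{n,n+2}=(\mathcal{R}\mathcal{R}^\top)_{n+2,n}=f_n$, $n\ge1$, where $$e_n = \frac{2(2m^2+(2n+3)m+n(n+1))}{(2n+2m-1)(2n+2m+3)},\qquad f_n = -\sqrt{\frac{n(n+1)(n+2m+2)(n+2m+3)}{(2n+2m+1)(2n+2m+3)^2(2n+2m+5)}}.$$ 3. The product $\mathcal{R}\mathcal{D}\mathcal{R}^\top$ is symmetric, its only possibly nonzero entries being $(\mathcal{R}\mathcal{D}\mathcal{R}^\top)_{n,n}=g_n$ and $(\mathcal{R}\mathcal{D}\mathcal{R}^\top)_{n,n+2}=(\mathcal{R}\mathcal{D}\mathcal{R}^\top)_{n+2,n}=h_n$, $n\ge1$, where $$g_n = \frac{4m^4+(12n+2)m^3+(14n^2+6n-6)m^2+(8n^3+8n^2-4n)m+2n(n+1)(n^2+n-1)}{(2n+2m-1)(2n+2m+3)},$$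 $$h_n = -(n+m+1)(n+m+2)\sqrt{\frac{n(n+1)(n+2m+2)(n+2m+3)}{(2n+2m+1)(2n+2m+3)^2(2n+2m+5)}}.$$
   Context: Semi-infinite matrices are indexed by $1,2,3,\dots$; all products below are finite sums entrywise. $\mathcal{M}$ is the matrix of multiplication by $1-x^2$ in the basis $\{\tilde P_{n-1+m}^m\}_{n\ge1}$ of $L^2([-1,1],dx)$-orthonormal associated Legendre functions of order $m$, where $\tilde P_\ell^m(x) = (-1)^m\sqrt{(\ell+\tfrac12)\frac{(\ell-m)!}{(\ell+m)!}}P_\ell^m(x)$ and $P_\ell^m$ carries the Condon–Shortley phase. Explicitly, $\mathcal{M}$ is symmetric positive-definite with only nonzero entries $\mathcal{M}_{n,n}=a_n$, $\mathcal{M}_{n,n+2}=\mathcal{M}_{n+2,n}=b_n$, where $$a_n = \dfrac{2(n^2+2mn+2m^2-n-m-1)}{(2n+2m-3)(2n+2m+1)},\qquad b_n = -\sqrt{\dfrac{n(n+1)(n+2m)(n+2m+1)}{(2n+2m-1)(2n+2m+1)^2(2n+2m+3)}}.$$ $\mathcal{D}$ is the diagonal matrix with $\mathcal{D}_{n,n}=(m+n-1)(m+n)$, $n\ge1$ (scaling the basis function $\tilde P_\ell^m$ by $\ell(\ell+1)$). $\mathcal{R}$ is the Cholesky factor of $\mathcal{M}$: the upper triangular matrix with positive diagonal such that $\mathcal{M}=\mathcal{R}^\top\mathcal{R}$. *)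

(* Defs.v *)
From HB Require Import structures.
From mathcomp Require Import all_boot all_order all_algebra.
From mathcomp Require Import all_classical all_reals all_analysis.
Set Implicit Arguments.
Unset Strict Implicit.
Unset Printing Implicit Defensive.
Import Order.TTheory GRing.Theory Num.Theory.
Import numFieldNormedType.Exports.
Local Open Scope classical_set_scope.
Local Open Scope ring_scope.

(* Rows and columns are indexed by 1, 2, 3, ...: the entries with a zero index
   are meaningless, and no definition below depends on them. *)
Definition simatrix (R : Type) := nat -> nat -> R.

Section SemiInfiniteMatrices.
Context {R : realType}.
Implicit Types A B : simatrix R.

Definition sitr A : simatrix R := fun i j => A j i.

(* The sum over a set has the value 0 when infinitely many terms are nonzero;
   [finite_products A B] says that this does not happen. *)
Definition simul A B : simatrix R :=
  fun i j => \sum_(k \in [set k : nat | (0 < k)%N]) (A i k * B k j).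

Definition finite_products A B : Prop :=
  forall i j : nat, (0 < i)%N -> (0 < j)%N ->
    finite_set [set k : nat | (0 < k)%N /\ A i k * B k j != 0].

Definition si_symmetric A : Prop :=
  forall i j : nat, (0 < i)%N -> (0 < j)%N -> A i j = A j i.

Definition si_upper_triangular A : Prop :=
  forall i j : nat, (0 < i)%N -> (0 < j)%N -> (j < i)%N -> A i j = 0.

(* The sums in [simul (sitr L) L] are finite because [L] is upper triangular. *)
Definition cholesky_factor A (L : simatrix R) : Prop :=
  [/\ si_upper_triangular L,
      forall n : nat, (0 < n)%N -> 0 < L n n
    & forall i j : nat, (0 < i)%N -> (0 < j)%N ->
        A i j = simul (sitr L) L i j].

End SemiInfiniteMatrices.

Section Legendre.
Context {R : realType}.

(* Rodrigues' formula. *)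
Definition legendre (l : nat) : {poly R} :=
  (2 ^+ l * l`!%:R)^-1 *: (('X^2 - 1) ^+ l)^`(l).

(* P_l^m(x) = (-1)^m (1 - x^2)^(m/2) (d/dx)^m P_l(x), the factor (-1)^m being
   the Condon-Shortley phase. *)
Definition assoc_legendre (l m : nat) (x : R) : R :=
  (-1) ^+ m * Num.sqrt (1 - x ^+ 2) ^+ m * ((legendre l)^`(m)).[x].

(* Only meaningful for m <= l, as l - m is a truncated subtraction. *)
Definition normalized_assoc_legendre (l m : nat) (x : R) : R :=
  (-1) ^+ m
  * Num.sqrt ((l%:R + 2^-1) * ((l - m)`!%:R / (l + m)`!%:R))
  * assoc_legendre l m x.

Definition legendre_basis (m n : nat) : R -> R :=
  normalized_assoc_legendre (n - 1 + m) m.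

(* The (i, j) entry of the matrix of a multiplication operator in an
   orthonormal basis is the L^2 inner product of the i-th basis function with
   the image of the j-th one. *)
Definition mxM (m : nat) : simatrix R := fun i j =>
  \int[lebesgue_measure]_(x in `[-1, 1])
    (legendre_basis m i x * ((1 - x ^+ 2) * legendre_basis m j x)).

Definition mxD (m : nat) : simatrix R := fun i j =>
  if i == j then (m%:R + i%:R - 1) * (m%:R + i%:R) else 0.

End Legendre.

Section Entries.
Context {R : realType}.
Implicit Types m n : nat.

Definition entry_c m n : R :=
  let m : R := m%:R in let n : R := n%:R in
  Num.sqrt (((n + 2 * m) * (n + 2 * m + 1))
            / ((2 * n + 2 * m - 1) * (2 * n + 2 * m + 1))).

Definition entry_d m n : R :=
  let m : R := m%:R in let n : R := n%:R in
  - Num.sqrt ((n * (n + 1))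
              / ((2 * n + 2 * m + 1) * (2 * n + 2 * m + 3))).

Definition entry_e m n : R :=
  let m : R := m%:R in let n : R := n%:R in
  2 * (2 * m ^+ 2 + (2 * n + 3) * m + n * (n + 1))
  / ((2 * n + 2 * m - 1) * (2 * n + 2 * m + 3)).

Definition entry_f m n : R :=
  let m : R := m%:R in let n : R := n%:R in
  - Num.sqrt ((n * (n + 1) * (n + 2 * m + 2) * (n + 2 * m + 3))
              / ((2 * n + 2 * m + 1) * (2 * n + 2 * m + 3) ^+ 2
                 * (2 * n + 2 * m + 5))).

Definition entry_g m n : R :=
  let m : R := m%:R in let n : R := n%:R in
  (4 * m ^+ 4 + (12 * n + 2) * m ^+ 3 + (14 * n ^+ 2 + 6 * n - 6) * m ^+ 2
   + (8 * n ^+ 3 + 8 * n ^+ 2 - 4 * n) * m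
   + 2 * n * (n + 1) * (n ^+ 2 + n - 1))
  / ((2 * n + 2 * m - 1) * (2 * n + 2 * m + 3)).

Definition entry_h m n : R :=
  let m : R := m%:R in let n : R := n%:R in
  - ((n + m + 1) * (n + m + 2)
     * Num.sqrt ((n * (n + 1) * (n + 2 * m + 2) * (n + 2 * m + 3))
                 / ((2 * n + 2 * m + 1) * (2 * n + 2 * m + 3) ^+ 2
                    * (2 * n + 2 * m + 5)))).

End Entries.

(* Main.v *)
Require Import Defs.
From HB Require Import structures.
From mathcomp Require Import all_boot all_order all_algebra.
From mathcomp Require Import all_classical all_reals all_analysis.
From mathcomp Require Import ring lra zify.
Import Order.TTheory GRing.Theory Num.Theory.
Import numFieldNormedType.Exports.
Local Open Scope ring_scope.

(** Since (2l + 1) P_l = P'_(l+1) - P'_(l-1), multiplication by sqrt (1 - x^2)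
    maps the orthonormal associated Legendre function of order m and degree l
    to a combination of those of order m + 1 and degrees l + 1 and l - 1.  The
    matrix of this map between the two orthonormal families is upper
    triangular with positive diagonal, so it is a Cholesky factor of the matrix
    of multiplication by 1 - x^2, and Cholesky factors are unique.

    Orthonormality comes from the dot products
    A_n(k, l) = int_(-1)^1 (1 - x^2)^n P_k^(n) P_l^(n):  Legendre's equation
    gives A_(n+1)(k, l) = (k - n)(k + n + 1) A_n(k, l), and comparison with the
    same identity for (l, k) yields orthogonality. *)

(** * Integration of polynomials over [-1, 1] *)

Section PolynomialIntegral.
Context {R : realType}.
Implicit Types p q : {poly R}.

Definition integral11 p : R :=
  \int[lebesgue_measure]_(x in `[(-1)%R, 1%R]) p.[x].

Lemma integral11_deriv q : integral11 q^`() = q.[1] - q.[-1].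
Proof.
rewrite /integral11 /Rintegral (@continuous_FTC2 _ _ (horner q)) //.
- exact/continuous_subspaceT/continuous_horner.
- split=> [x _||]; first exact: derivable_horner.
  + by apply: cvg_at_right_filter; exact: continuous_horner.
  + by apply: cvg_at_left_filter; exact: continuous_horner.
- by move=> x _; rewrite -derivE.
Qed.

Lemma poly_antiderivative p : exists q, q^`() = p.
Proof.
(* At i = 0 the coefficient is a division by zero, hence 0: the constant of integration. *)
exists (\poly_(i < (size p).+1) (p`_i.-1 / i%:R)).
apply/polyP => i; rewrite coef_deriv coef_poly ltnS.
case: ltnP => [_|le_p_i] /=; last by rewrite mul0rn nth_default.
by rewrite -[LHS]mulr_natr divfK // pnatr_eq0.
Qed.

(** Every polynomial is a derivative, so linearity reduces to that of evaluation at the end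
    points. *)
Lemma integral11_linear : linear integral11.
Proof.
move=> a p1 p2.
have [q1 <-] := poly_antiderivative p1; have [q2 <-] := poly_antiderivative p2.
by rewrite -derivZ -derivD !integral11_deriv !hornerE /GRing.scale /=; ring.
Qed.

HB.instance Definition _ :=
  GRing.isLinear.Build R {poly R} R _ integral11 integral11_linear.

Lemma integral11D p q : integral11 (p + q) = integral11 p + integral11 q.
Proof. exact: raddfD. Qed.

Lemma integral11Z a p : integral11 (a *: p) = a * integral11 p.
Proof. exact: linearZ. Qed.

Lemma integral11_by_parts p q : integral11 (p * q^`()) =
  (p * q).[1] - (p * q).[-1] - integral11 (p^`() * q).
Proof.
by rewrite -integral11_deriv derivM raddfD addrAC subrr add0r.
Qed.

End PolynomialIntegral.

Lemma derivn_derivn (R : nzSemiRingType) (p : {poly R}) a b :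
  p^`(a)^`(b) = p^`(a + b).
Proof. by elim: b => [|b IH]; rewrite ?addn0 // addnS !derivnS IH. Qed.

(** * Recurrence and differential equation of Legendre polynomials *)

Section LegendrePolynomials.
Context {R : realType}.
Local Notation P := (@legendre R).

Local Ltac polyC_ring :=
  rewrite -?mul_polyC ?(polyCM, polyCB, polyCD, polyCN, polyC_natr, polyC1);
  ring.

Lemma deriv_X2sub1_exp l :
  (('X^2 - 1 : {poly R}) ^+ l.+1)^`()
  = (2 * l.+1%:R) *: ('X * ('X^2 - 1) ^+ l).
Proof.
by rewrite deriv_exp derivB derivXn -(polyC1 R) derivC subr0 /= expr1; polyC_ring.
Qed.

(** Writing X^2 as (X^2 - 1) + 1 leaves only powers of X^2 - 1, the shape needed for Rodrigues'
    formula. *)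
Lemma deriv2_X2sub1_exp l :
  (('X^2 - 1 : {poly R}) ^+ l.+2)^`(2) =
  (2 * l.+2%:R) *: ((2 * l.+1%:R + 1) *: ('X^2 - 1) ^+ l.+1
                    + (2 * l.+1%:R) *: ('X^2 - 1) ^+ l).
Proof.
rewrite derivnS derivn1 deriv_X2sub1_exp derivZ derivM derivX.
by rewrite deriv_X2sub1_exp [_ ^+ l.+1]exprS; polyC_ring.
Qed.

Lemma legendre0 : P 0 = 1.
Proof. by rewrite /legendre !expr0 derivn0 fact0 mulr1 invr1 scale1r. Qed.

Lemma legendre1 : P 1 = 'X.
Proof.
rewrite /legendre derivn1 deriv_X2sub1_exp expr0 mulr1 expr1 factS fact0.
by rewrite muln1 !mulr1 scalerA mulVf ?scale1r ?pnatr_eq0.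
Qed.

(** Of the l + 3 derivatives in Rodrigues' formula, two are carried out by [deriv2_X2sub1_exp]; the
    other l + 1 turn the two resulting powers into multiples of [P l.+1] and of the derivative of
    [P l]. *)
Lemma deriv_legendre l :
  (P l.+2)^`() = (2 * l.+1%:R + 1) *: P l.+1 + (P l)^`().
Proof.
have fz k : k`!%:R != 0 :> R by rewrite pnatr_eq0 -lt0n fact_gt0.
have tz k : 2 ^+ k != 0 :> R by rewrite expf_neq0 // pnatr_eq0.
rewrite /legendre !derivZ -!derivnS.
rewrite -[l.+3]/(2 + l.+1)%N -derivn_derivn.
rewrite deriv2_X2sub1_exp derivnZ derivnD !derivnZ !scalerDr !scalerA.
have l0 : 0 <= l%:R :> R by [].
by congr (_ *: _ + _ *: _); rewrite !exprS !factS !natrM; field;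
  rewrite fz tz !lt0r_neq0 //; lra.
Qed.

(** For v = (X^2 - 1)^l one has (X^2 - 1) v' = 2l X v. Differentiating once gives n = 0, and each
    further derivative raises n by one. *)
Lemma X2sub1_exp_ode l n :
  ('X^2 - 1) * (('X^2 - 1 : {poly R}) ^+ l)^`(n.+2)
  + (2 * (n%:R + 1 - l%:R)) *: ('X * (('X^2 - 1) ^+ l)^`(n.+1))
  + ((n%:R + 1) * (n%:R - 2 * l%:R)) *: (('X^2 - 1) ^+ l)^`(n) = 0.
Proof.
have dw : ('X^2 - 1 : {poly R})^`() = 2 *: 'X.
  by have := deriv_X2sub1_exp 0; rewrite !expr1 expr0 !mulr1.
elim: n => [|n IH].
  set v := _ ^+ l; rewrite derivn0 derivnS derivn1.
  have E : ('X^2 - 1) * v^`() = (2 * l%:R) *: ('X * v).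
    rewrite /v; case: l {v} => [|l].
      by rewrite expr0 -(polyC1 R) derivC !mulr0 scale0r.
    by rewrite deriv_X2sub1_exp (exprS _ l); polyC_ring.
  have := congr1 deriv E; rewrite derivM dw derivZ derivM derivX mul1r.
  move=> E'; have -> : ('X^2 - 1) * v^`()^`() =
    (2 * l%:R) *: (v + 'X * v^`()) - 2 *: 'X * v^`() by rewrite -E'; ring.
  polyC_ring.
have := congr1 deriv IH.
rewrite !derivD !derivZ !derivM dw derivX deriv0 -!derivnS => E.
rewrite -[RHS]E -addn1 !natrD; polyC_ring.
Qed.

(** Legendre's equation differentiated n times, obtained from [X2sub1_exp_ode] at order l + n. *)
Lemma derivn_legendre_ode l n :
  (1 - 'X^2) * (P l)^`(n.+2) =
  (2 * (n%:R + 1)) *: ('X * (P l)^`(n.+1))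
  - ((l%:R - n%:R) * (l%:R + n%:R + 1)) *: (P l)^`(n).
Proof.
rewrite /legendre !derivnZ.
rewrite !derivn_derivn !addnS; set c := (_ * _)^-1.
have := X2sub1_exp_ode l (l + n).
set d2 := _^`(_.+2); set d1 := _^`(_.+1); set d0 := _^`(_) => E.
have -> : (1 - 'X^2) * (c *: d2) = - c *: (('X^2 - 1) * d2).
  by polyC_ring.
have -> : ('X^2 - 1) * d2 =
  - ((2 * ((l + n)%:R + 1 - l%:R)) *: ('X * d1)
     + (((l + n)%:R + 1) * ((l + n)%:R - 2 * l%:R)) *: d0).
  by apply/eqP; rewrite -addr_eq0 addrA E.
rewrite natrD; polyC_ring.
Qed.

(** Sturm-Liouville form: the derivative of the weight cancels the first-order term of
    [derivn_legendre_ode]. *)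
Lemma deriv_weighted_derivn_legendre l n :
  ((1 - 'X^2) ^+ n.+1 * (P l)^`(n.+1))^`() =
  - ((l%:R - n%:R) * (l%:R + n%:R + 1)) *: ((1 - 'X^2) ^+ n * (P l)^`(n)).
Proof.
have dw : (1 - 'X^2 : {poly R})^`() = - (2 *: 'X).
  by rewrite derivB -(polyC1 R) derivC derivXn sub0r expr1 scaler_nat.
rewrite derivM deriv_exp dw -derivnS (exprSr _ n) -mulrA derivn_legendre_ode /=.
by polyC_ring.
Qed.

(** * Orthogonality and norms of the derivatives of Legendre polynomials *)

Definition derivn_legendre_dot n k l : R :=
  integral11 ((1 - 'X^2) ^+ n * (P k)^`(n) * (P l)^`(n)).

Lemma derivn_legendre_dotC n k l :
  derivn_legendre_dot n k l = derivn_legendre_dot n l k.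
Proof. by rewrite /derivn_legendre_dot mulrAC. Qed.

(** Integration by parts: the boundary terms vanish because the weight is zero at 1 and -1. *)
Lemma derivn_legendre_dotS n k l :
  derivn_legendre_dot n.+1 k l =
  (k%:R - n%:R) * (k%:R + n%:R + 1) * derivn_legendre_dot n k l.
Proof.
rewrite /derivn_legendre_dot [X in _ * X]derivnS integral11_by_parts.
rewrite deriv_weighted_derivn_legendre -scalerAl integral11Z mulNr opprK.
have w1 : (1 - 'X^2 : {poly R}).[1] = 0 by rewrite !hornerE expr1n subrr.
have wN1 : (1 - 'X^2 : {poly R}).[-1] = 0.
  by rewrite !hornerE sqrrN expr1n subrr.
by rewrite !hornerM !horner_exp w1 wN1 expr0n !mul0r subrr add0r.
Qed.

Lemma derivn_legendre_orthogonal n k l :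
  k != l -> derivn_legendre_dot n k l = 0.
Proof.
move=> kl; have := derivn_legendre_dotS n k l.
rewrite derivn_legendre_dotC derivn_legendre_dotS derivn_legendre_dotC => E.
(* The factors of [derivn_legendre_dotS] for k and for l differ by (k - l)(k + l + 1), whatever n
   is. *)
have {E} /eqP : (k%:R - l%:R) * (k%:R + l%:R + 1) * derivn_legendre_dot n k l = 0.
  by move/eqP: E; rewrite -subr_eq0 => /eqP E; rewrite -[RHS]oppr0 -[in RHS]E; ring.
rewrite !mulf_eq0 subr_eq0 eqr_nat (negPf kl) /= -!natrD.
by rewrite -(natrD _ _ 1) pnatr_eq0 addn1 /= => /eqP.
Qed.

(** At 1 the leading term of Legendre's equation vanishes, which ties the derivative to the value;
    [deriv_legendre] then gives an induction in steps of two. *)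
Lemma legendre_at_1 l : (P l).[1] = 1.
Proof.
have ode k : 2 * (P k)^`().[1] = k%:R * (k%:R + 1) * (P k).[1].
  have := congr1 (horner^~ 1) (derivn_legendre_ode k 0).
  rewrite derivn0 derivn1 !hornerE /= expr1n subrr mul0r => E.
  by apply: subr0_eq; rewrite [RHS]E; ring.
suff [] : (P l).[1] = 1 /\ (P l.+1).[1] = 1 by [].
elim: l => [|l [IH0 IH1]]; first by rewrite legendre0 legendre1 !hornerE.
split => //; have := congr1 (horner^~ 1) (deriv_legendre l).
rewrite hornerD hornerZ IH1 => /(congr1 ( *%R 2)).
rewrite mulrDr !ode IH0 => E.
have nz : l.+2%:R * (l.+2%:R + 1) != 0 :> R.
  by rewrite -(natrD _ _ 1) -natrM pnatr_eq0.
apply: (mulfI nz); rewrite E -[l.+2]addn2 -[l.+1]addn1 !natrD; ring.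
Qed.

Lemma legendre_at_N1 l : (P l).[-1] = (-1) ^+ l.
Proof.
have ode k : 2 * (P k)^`().[-1] = - (k%:R * (k%:R + 1) * (P k).[-1]).
  have := congr1 (horner^~ (-1)) (derivn_legendre_ode k 0).
  rewrite derivn0 derivn1 !hornerE /= sqrrN expr1n subrr mul0r => E.
  by apply: subr0_eq; rewrite -[RHS]oppr0 [in RHS]E; ring.
suff [] : (P l).[-1] = (-1) ^+ l /\ (P l.+1).[-1] = (-1) ^+ l.+1 by [].
elim: l => [|l [IH0 IH1]]; first by rewrite legendre0 legendre1 !hornerE.
split => //; have := congr1 (horner^~ (-1)) (deriv_legendre l).
rewrite hornerD hornerZ IH1 => /(congr1 ( *%R 2)).
rewrite mulrDr !ode IH0 => E.
have nz : l.+2%:R * (l.+2%:R + 1) != 0 :> R.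
  by rewrite -(natrD _ _ 1) -natrM pnatr_eq0.
apply: (mulfI nz); apply: oppr_inj; rewrite E.
by rewrite -[l.+2]addn2 -[l.+1]addn1 !natrD !exprD; ring.
Qed.

(** By [deriv_legendre] the derivative of [P k] is a combination of polynomials [P j] with j < k,
    all orthogonal to [P l]. *)
Lemma integral11_legendre_deriv l k :
  (k <= l)%N -> integral11 (P l * (P k)^`()) = 0.
Proof.
suff H : forall k, ((k <= l)%N -> integral11 (P l * (P k)^`()) = 0) /\
                   ((k.+1 <= l)%N -> integral11 (P l * (P k.+1)^`()) = 0).
  by have [] := H k.
have orth j : (j < l)%N -> integral11 (P l * P j) = 0.
  move=> jl; have := derivn_legendre_orthogonal 0 l j.
  by rewrite /derivn_legendre_dot expr0 mul1r !derivn0; apply; rewrite gtn_eqF.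
elim=> [|n [IH0 IH1]].
  rewrite legendre0 legendre1 derivX mulr1 -(polyC1 R) derivC mulr0.
  split=> [_|l0]; first exact: raddf0.
  by rewrite -[P l]mulr1 -[X in _ * X]legendre0 orth.
split=> // nl; rewrite deriv_legendre mulrDr -scalerAr integral11D integral11Z.
by rewrite IH0 ?orth ?mulr0 ?addr0 //; lia.
Qed.

Lemma legendre_sqnorm l : derivn_legendre_dot 0 l l = 2 / (2 * l%:R + 1).
Proof.
have nz : 2 * l%:R + 1 != 0 :> R by rewrite -natrM -(natrD _ _ 1) pnatr_eq0 addn1.
rewrite /derivn_legendre_dot expr0 mul1r !derivn0.
case: l nz => [|l] nz.
  have := @integral11_deriv R 'X.
  rewrite derivX legendre0 mulr1 !hornerE opprK => ->.
  by rewrite divr1.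
apply: (mulfI nz); rewrite mulrCA divff // mulr1.
(* This integral is computed twice: by parts only the boundary terms survive, while by the
   recurrence it is 2(l + 1) + 1 times the squared norm. *)
have : integral11 (P l.+1 * (P l.+2)^`()) = 2.
  rewrite integral11_by_parts mulrC [X in _ - X](_ : _ = 0).
    rewrite !hornerM !legendre_at_1 !legendre_at_N1 !exprS.
    have : ((-1) ^+ l * (-1) ^+ l = 1 :> R) by rewrite -exprMn mulrNN mulr1 expr1n.
    by set s := _ ^+ l => ss; rewrite mulr1 subr0; ring: ss.
  by rewrite mulrC integral11_legendre_deriv.
rewrite deriv_legendre mulrDr -scalerAr integral11D integral11Z.
by rewrite integral11_legendre_deriv ?addr0 //; lia.
Qed.

(** Passing from order n to n + 1 at the fixed degree k + n + 1 contributes the factor (k + 1)(k +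
    2n + 2), whence the factorials. *)
Lemma derivn_legendre_sqnorm n k :
  derivn_legendre_dot n (k + n) (k + n) =
  2 * (k + 2 * n)`!%:R / ((2 * (k + n)%:R + 1) * k`!%:R).
Proof.
have fz j : j`!%:R != 0 :> R by rewrite pnatr_eq0 -lt0n fact_gt0.
elim: n k => [|n IH] k.
  by rewrite legendre_sqnorm !addn0; field; rewrite fz /=;
     rewrite -natrM -(natrD _ _ 1) pnatr_eq0 addn1.
rewrite derivn_legendre_dotS -addSnnS IH.
have -> : (k + 2 * n.+1 = (k.+1 + 2 * n).+1)%N by lia.
rewrite !factS !natrM; field.
have n0 : 0 <= n%:R :> R by [].
have k0 : 0 <= k%:R :> R by [].
by rewrite fz !lt0r_neq0 //; lra.
Qed.

End LegendrePolynomials.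

Lemma sqrtr_eq (R : rcfType) (x y : R) : 0 <= y -> y ^+ 2 = x -> Num.sqrt x = y.
Proof. by move=> y0 <-; rewrite sqrtr_sqr ger0_norm. Qed.

(** * Orthonormal associated Legendre functions and the change of order from m to m + 1 *)

Section CholeskyFactor.
Context {R : realType}.
Local Notation P := (@legendre R).

Lemma derivn_legendre_eq0 l n : (l < n)%N -> (P l)^`(n) = 0.
Proof.
move=> ln; rewrite /legendre derivnZ derivn_derivn derivn_poly0 ?scaler0 //.
apply: leq_trans (size_poly_exp_leq _ _) _.
by rewrite -(polyC1 R) size_XnsubC //=; lia.
Qed.

Lemma integral11_scale2 (w p q : {poly R}) a b :
  integral11 (w * (a *: p) * (b *: q)) = a * b * integral11 (w * p * q).
Proof. by rewrite -!scalerAr -scalerAl !integral11Z mulrCA mulrA. Qed.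

(** The normalization constant in degree l = k + m, where l - m = k and l + m = k + 2m; k counts
    from 0. *)
Definition legendre_coef m k : R :=
  Num.sqrt (((k + m)%:R + 2^-1) * (k`!%:R / (k + 2 * m)`!%:R)).

Definition legendre_orthopoly m k : {poly R} :=
  legendre_coef m k *: (P (k + m))^`(m).
Local Notation phi := legendre_orthopoly.

Lemma legendre_basisE m k x :
  legendre_basis m k.+1 x = Num.sqrt (1 - x ^+ 2) ^+ m * (phi m k).[x].
Proof.
rewrite /legendre_basis /normalized_assoc_legendre /assoc_legendre subn1 /=.
rewrite addnK -addnA addnn -mul2n hornerZ.
have : (-1) ^+ m * (-1) ^+ m = 1 :> R by rewrite -exprMn mulrNN mulr1 expr1n.
by rewrite /legendre_coef; set s := (-1) ^+ m => ss; ring: ss.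
Qed.

(** The matrix is thus the Gram matrix of the order m polynomials for the weight of order m + 1, for
    which those of order m + 1 are orthonormal. *)
Lemma mxM_integral m i j : mxM m i.+1 j.+1 =
  integral11 ((1 - 'X^2) ^+ m.+1 * phi m i * phi m j) :> R.
Proof.
apply: eq_Rintegral => x; rewrite inE /= in_itv /= => /andP[x1 x2].
have w0 : 0 <= 1 - x ^+ 2 by nra.
have wX : (1 - 'X^2 : {poly R}).[x] = 1 - x ^+ 2 by rewrite !hornerE.
have wm : (1 - x ^+ 2) ^+ m
          = Num.sqrt (1 - x ^+ 2) ^+ m * Num.sqrt (1 - x ^+ 2) ^+ m.
  by rewrite -exprMn -expr2 sqr_sqrtr.
by rewrite !legendre_basisE !hornerM horner_exp wX (exprS _ m) wm; ring.
Qed.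

Lemma legendre_orthopoly_orthonormal m k l :
  integral11 ((1 - 'X^2) ^+ m * phi m k * phi m l) = (k == l)%:R.
Proof.
rewrite /legendre_orthopoly integral11_scale2.
rewrite -/(derivn_legendre_dot m (k + m) (l + m)).
have [<-|kl] := eqVneq k l; last first.
  by rewrite derivn_legendre_orthogonal ?mulr0 // eqn_add2r.
rewrite derivn_legendre_sqnorm -expr2 sqr_sqrtr; last first.
  by rewrite mulr_ge0 // ?addr_ge0 ?invr_ge0.
have fz j : j`!%:R != 0 :> R by rewrite pnatr_eq0 -lt0n fact_gt0.
rewrite natrD [RHS](_ : _ = 1) //.
have m0 : 0 <= m%:R :> R by [].
have k0 : 0 <= k%:R :> R by [].
by field; rewrite !fz !lt0r_neq0 //; lra.
Qed.

(** The last factor is that of the recurrence; after normalization, [entry_c m k.+1] becomes the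
    coefficient of [phi m.+1 k] in [phi m k]. *)
Lemma entry_c_legendre_coef m k :
  legendre_coef m k =
  entry_c m k.+1 * legendre_coef m.+1 k * (2 * (k + m)%:R + 1).
Proof.
have m0 : 0 <= m%:R :> R by [].
have k0 : 0 <= k%:R :> R by [].
apply: sqrtr_eq; first by rewrite !mulr_ge0 ?sqrtr_ge0 ?addr_ge0 ?mulr_ge0.
have fz j : j`!%:R != 0 :> R by rewrite pnatr_eq0 -lt0n fact_gt0.
rewrite !exprMn !sqr_sqrtr; last 2 first.
- by rewrite !mulr_ge0 // ?addr_ge0 ?invr_ge0.
- rewrite -natr1 divr_ge0 // mulr_ge0 //; lra.
have -> : (k + 2 * m.+1 = (k + 2 * m).+2)%N by lia.
rewrite !factS !natrM.
by field; rewrite !fz !lt0r_neq0 //; lra.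
Qed.

Lemma entry_d_legendre_coef m k :
  legendre_coef m k.+2 =
  - entry_d m k.+1 * legendre_coef m.+1 k * (2 * (k.+2 + m)%:R + 1).
Proof.
have m0 : 0 <= m%:R :> R by [].
have k0 : 0 <= k%:R :> R by [].
rewrite opprK.
apply: sqrtr_eq; first by rewrite !mulr_ge0 ?sqrtr_ge0 ?addr_ge0 ?mulr_ge0.
have fz j : j`!%:R != 0 :> R by rewrite pnatr_eq0 -lt0n fact_gt0.
rewrite !exprMn !sqr_sqrtr; last 2 first.
- by rewrite !mulr_ge0 // ?addr_ge0 ?invr_ge0.
- rewrite -natr1 divr_ge0 // mulr_ge0 //; lra.
have -> : (k + 2 * m.+1 = (k + 2 * m).+2)%N by lia.
have -> : (k.+2 + 2 * m = (k + 2 * m).+2)%N by lia.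
rewrite !factS !natrM.
by field; rewrite !fz !lt0r_neq0 //; lra.
Qed.

(** Column j holds the coordinates of the j-th function of order m in the family of order m + 1. *)
Definition cholesky_mx m : simatrix R := fun i j =>
  if j == i then entry_c m i else if j == i.+2 then entry_d m i else 0.

Lemma derivn_legendre_rec m k :
  (P (k.+2 + m.+1))^`(m.+1) =
  (2 * (k.+2 + m)%:R + 1) *: (P (k.+2 + m))^`(m) + (P (k + m.+1))^`(m.+1).
Proof.
by rewrite derivSn addnS deriv_legendre derivnD derivnZ -derivSn addnS.
Qed.

(** The lower term of the recurrence is differentiated more often than its degree, so it drops
    out. *)
Lemma derivn_legendre_rec_le1 m k : (k <= 1)%N ->
  (P (k + m.+1))^`(m.+1) = (2 * (k + m)%:R + 1) *: (P (k + m))^`(m).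
Proof.
case: k => [|[|//]] _; last first.
  rewrite -[(1 + m.+1)%N]/m.+2 derivSn deriv_legendre derivnD derivnZ -derivSn.
  by rewrite [(P m)^`(_)]derivn_legendre_eq0 // addr0.
(* [deriv_legendre] starts at degree 2, so k = m = 0, which involves [P 1], is checked directly. *)
case: m => [|m].
  by rewrite !add0n derivn1 legendre1 derivX legendre0 mulr0 add0r scale1r.
rewrite derivSn !add0n deriv_legendre derivnD derivnZ -derivSn.
by rewrite [(P m)^`(_)]derivn_legendre_eq0 // addr0.
Qed.

Lemma legendre_orthopoly_expansion m j N : (j < N)%N ->
  phi m j = \sum_(k < N) cholesky_mx m k.+1 j.+1 *: phi m.+1 k.
Proof.
elim: N => // N IH; rewrite ltnS leq_eqVlt => /predU1P[->{IH}|jN]; last first.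
  rewrite big_ord_recr /= -IH // /cholesky_mx !eqSS.
  by rewrite !ltn_eqF ?scale0r ?addr0 //; lia.
have z0 n : n%:R * 2 + 1 != 0 :> R by rewrite lt0r_neq0 // ltr_wpDl ?mulr_ge0.
have diag k : cholesky_mx m k.+1 k.+1 = entry_c m k.+1.
  by rewrite /cholesky_mx eqxx.
rewrite big_ord_recr /= diag.
case: (leqP N 1) => [N1|].
  rewrite big1 => [|k _]; last first.
    rewrite /cholesky_mx !eqSS gtn_eqF // ltn_eqF ?scale0r //=.
    by move: (ltn_ord k); lia.
  rewrite add0r /legendre_orthopoly derivn_legendre_rec_le1 //.
  by rewrite !scalerA entry_c_legendre_coef.
case: N => [|[|N _]] //.
rewrite !big_ord_recr /= big1 => [|k _]; last first.
  rewrite /cholesky_mx !eqSS !gtn_eqF ?scale0r //=;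
  by move: (ltn_ord k); lia.
have -> : cholesky_mx m N.+1 N.+3 = entry_d m N.+1.
  by rewrite /cholesky_mx eqxx gtn_eqF.
have -> : cholesky_mx m N.+2 N.+3 = 0.
  by rewrite /cholesky_mx gtn_eqF // ltn_eqF.
rewrite add0r scale0r addr0 /legendre_orthopoly derivn_legendre_rec scalerDr scalerDr.
rewrite !scalerA -entry_c_legendre_coef addrCA -[LHS]addr0; congr (_ + _).
rewrite -scalerDl; apply/esym/eqP; rewrite scaler_eq0; apply/orP; left.
(* Two expressions of [legendre_coef m N.+2] share a nonzero factor; cancelling it shows that the
   terms in the lower-degree derivative add up to zero. *)
have := entry_c_legendre_coef m N.+2; rewrite entry_d_legendre_coef => E.
have nz : 2 * (N.+2 + m)%:R + 1 != 0 :> R by rewrite mulrC.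
by move/(mulIf nz): E => <-; apply/eqP; ring.
Qed.

(** * Existence and uniqueness of the Cholesky factor *)

Lemma simulE (A B : simatrix R) i j N :
  (forall k, (N <= k)%N -> A i k.+1 * B k.+1 j = 0) ->
  simul A B i j = \sum_(k < N) A i k.+1 * B k.+1 j.
Proof.
move=> AB0; rewrite /simul (@fsbigE _ _ _ _ _ [seq k.+1 | k <- iota 0 N]).
- by rewrite big_map -(big_mkord xpredT (fun k => A i k.+1 * B k.+1 j))
             /index_iota subn0; apply: eq_bigl => k; rewrite /= mem_set.
- by rewrite map_inj_uniq ?iota_uniq // => a b [].
- by move=> k /= /mapP[a _ ->].
- case=> // k _; rewrite mem_map => [|a b []] //.
  by rewrite mem_iota add0n /= -leqNgt => /AB0.
Qed.

Lemma simul_tr_upper (L : simatrix R) i j N : si_upper_triangular L ->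
  (i < N)%N ->
  simul (sitr L) L i.+1 j.+1 = \sum_(k < N) L k.+1 i.+1 * L k.+1 j.+1.
Proof.
move=> Lup iN; rewrite (@simulE _ _ _ _ N) // => k Nk.
by rewrite /sitr Lup ?mul0r // ltnS (leq_trans iN).
Qed.

Lemma cholesky_mx_upper m : si_upper_triangular (cholesky_mx m).
Proof.
by move=> i j _ _ ji; rewrite /cholesky_mx !ltn_eqF // (leq_trans ji) // leqW.
Qed.

Lemma entry_c_gt0 m n : (0 < n)%N -> 0 < entry_c m n :> R.
Proof.
case: n => // n _; rewrite sqrtr_gt0 -natr1.
have m0 : 0 <= m%:R :> R by [].
have n0 : 0 <= n%:R :> R by [].
by rewrite divr_gt0 // mulr_gt0 //; lra.
Qed.

Lemma entry_d_lt0 m n : (0 < n)%N -> entry_d m n < 0 :> R.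
Proof.
case: n => // n _; rewrite oppr_lt0 sqrtr_gt0 -natr1.
have m0 : 0 <= m%:R :> R by [].
have n0 : 0 <= n%:R :> R by [].
by rewrite divr_gt0 // mulr_gt0 //; lra.
Qed.

(** Expanding both functions in the Gram integral, orthonormality at order m + 1 leaves the sum of
    products of coordinates. *)
Lemma cholesky_mxP m : cholesky_factor (mxM m) (cholesky_mx m).
Proof.
split=> [|n n0|[//|i] [//|j] _ _]; first exact: cholesky_mx_upper.
  by rewrite /cholesky_mx eqxx entry_c_gt0.
pose N := (maxn i j).+1.
have iN : (i < N)%N by rewrite ltnS leq_maxl.
have jN : (j < N)%N by rewrite ltnS leq_maxr.
rewrite (simul_tr_upper _ _ _ N (cholesky_mx_upper m) iN) mxM_integral.
rewrite (legendre_orthopoly_expansion m _ _ iN) (legendre_orthopoly_expansion m _ _ jN).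
rewrite [X in X * _]mulr_sumr mulr_suml raddf_sum; apply: eq_bigr => k _ /=.
rewrite mulr_sumr raddf_sum (bigD1 k) //= big1 => [|l lk].
  rewrite integral11_scale2.
  by rewrite legendre_orthopoly_orthonormal eqxx addr0 mulr1.
rewrite integral11_scale2.
by rewrite legendre_orthopoly_orthonormal eq_sym (negPf (lk : nat_of_ord l != k)) mulr0.
Qed.

(** Induction on rows: the contributions of earlier rows cancel, the diagonal entries then have
    equal squares and are positive, and dividing by them gives the rest of the row. *)
Lemma cholesky_factor_uniq (A L K : simatrix R) :
  cholesky_factor A L -> cholesky_factor A K ->
  forall i j, (0 < i)%N -> (0 < j)%N -> L i j = K i j.
Proof.
move=> [Lup Lpos AL] [Kup Kpos AK] [//|i] [//|j] _ _.
elim/ltn_ind: i j => i IH j.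
have E n : L i.+1 i.+1 * L i.+1 n.+1 = K i.+1 i.+1 * K i.+1 n.+1.
  have := AL i.+1 n.+1 isT isT; rewrite AK // !(@simul_tr_upper _ i n i.+1) //.
  rewrite !big_ord_recr /=.
  under eq_bigr => k _ do rewrite -!(IH k) //.
  by move/addrI/esym.
have D : L i.+1 i.+1 = K i.+1 i.+1.
  apply/eqP; rewrite -(@eqrXn2 _ 2) ?ltW ?Lpos ?Kpos //.
  by rewrite !expr2 E.
have := E j; rewrite D => /mulfI; apply.
by rewrite lt0r_neq0 ?Kpos.
Qed.

End CholeskyFactor.

(** * Products of bidiagonal matrices *)

Section CholeskyProducts.
Context {R : realType}.
Implicit Types L D : simatrix R.

(** The second diagonal is the one of the entries (i, i + 2). *)
Definition bidiagonal L := forall i j, (0 < i)%N -> (0 < j)%N ->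
  j != i -> j != i.+2 -> L i j = 0.

Definition diagonal D := forall i j, (0 < i)%N -> (0 < j)%N ->
  j != i -> D i j = 0.

Lemma simul_bidiagonal L (A : simatrix R) i j : bidiagonal L -> (0 < i)%N ->
  simul L A i j = L i i * A i j + L i i.+2 * A i.+2 j.
Proof.
move=> Lb; case: i => // i _.
rewrite (simulE _ _ _ _ i.+3) => [|k ik]; last first.
  by rewrite Lb ?mul0r // eqSS gtn_eqF //; lia.
rewrite !big_ord_recr big1 /= => [|k _]; last first.
  by rewrite Lb ?mul0r // eqSS ltn_eqF //; move: (ltn_ord k); lia.
by rewrite add0r [L i.+1 i.+2]Lb ?mul0r ?addr0 //; lia.
Qed.

Lemma finite_products_bidiagonal L (A : simatrix R) :
  bidiagonal L -> finite_products L A.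
Proof.
move=> Lb i j i0 j0; apply: (sub_finite_set _ (finite_II i.+3)) => k /= [k0].
apply: contraNT; rewrite -leqNgt => ik.
by rewrite Lb ?mul0r // gtn_eqF //; lia.
Qed.

Lemma simul_bidiagonal_diagonal L D i j : bidiagonal L -> diagonal D ->
  (0 < i)%N -> (0 < j)%N -> simul L D i j = L i j * D j j.
Proof.
move=> Lb Dd i0 j0; rewrite simul_bidiagonal //.
have [->|ji] := eqVneq j i; first by rewrite [D i.+2 i]Dd ?mulr0 ?addr0 //; lia.
have [->|ji2] := eqVneq j i.+2; first by rewrite [D i _]Dd ?mulr0 ?add0r //; lia.
by rewrite [L i j]Lb // [D i j]Dd // [D i.+2 j]Dd // !mulr0 mul0r addr0.
Qed.

(** This lets R D R^T be treated, like R R^T, as a bidiagonal matrix times the transpose of one. *)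
Lemma bidiagonal_mul_diagonal L D : bidiagonal L -> diagonal D ->
  bidiagonal (simul L D).
Proof.
move=> Lb Dd i j i0 j0 ji ji2.
by rewrite simul_bidiagonal_diagonal // Lb ?mul0r.
Qed.

Lemma simul_tr_diagE L K i : bidiagonal L -> (0 < i)%N ->
  simul L (sitr K) i i = L i i * K i i + L i i.+2 * K i i.+2.
Proof. by move=> Lb i0; rewrite simul_bidiagonal. Qed.

Lemma simul_tr_superdiagE L K i : bidiagonal L -> bidiagonal K -> (0 < i)%N ->
  simul L (sitr K) i i.+2 = L i i.+2 * K i.+2 i.+2.
Proof.
move=> Lb Kb i0; rewrite simul_bidiagonal // /sitr [K i.+2 i]Kb ?mulr0 ?add0r //;
  lia.
Qed.

Lemma simul_tr_eq0 L K i j : bidiagonal L -> bidiagonal K ->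
  (0 < i)%N -> (0 < j)%N -> j != i -> j != i.+2 -> i != j.+2 ->
  simul L (sitr K) i j = 0.
Proof.
move=> Lb Kb i0 j0 ji ji2 ij2; rewrite simul_bidiagonal // /sitr.
rewrite [K j i]Kb ?[K j i.+2]Kb ?mulr0 ?addr0 //; lia.
Qed.

Lemma si_symmetric_mul_tr L : si_symmetric (simul L (sitr L)).
Proof. by move=> i j _ _; apply: eq_fsbigr => k _; rewrite mulrC. Qed.

Lemma si_symmetric_mul_diagonal_tr L D : bidiagonal L -> diagonal D ->
  si_symmetric (simul (simul L D) (sitr L)).
Proof.
move=> Lb Dd i j i0 j0; apply: eq_fsbigr => k; rewrite inE /= => k0.
by rewrite !simul_bidiagonal_diagonal // /sitr; ring.
Qed.

(** * Closed forms and signs of the entries *)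

Lemma entry_eE m n : (0 < n)%N ->
  entry_c m n * entry_c m n + entry_d m n * entry_d m n = entry_e m n :> R.
Proof.
case: n => // n _; have m0 : 0 <= m%:R :> R by [].
have n0 : 0 <= n%:R :> R by [].
rewrite -!expr2 sqrrN !sqr_sqrtr -?natr1 ?divr_ge0 ?mulr_ge0 //; try lra.
by rewrite /entry_e -natr1; field; rewrite !lt0r_neq0 //; lra.
Qed.

Lemma entry_fE m n : (0 < n)%N ->
  entry_d m n * entry_c m n.+2 = entry_f m n :> R.
Proof.
case: n => // n _; have m0 : 0 <= m%:R :> R by [].
have n0 : 0 <= n%:R :> R by [].
rewrite /entry_d /entry_c /entry_f mulNr -sqrtrM -!natr1; last first.
  by rewrite divr_ge0 // mulr_ge0 //; lra.
by congr (- Num.sqrt _); field; rewrite !lt0r_neq0 //; lra.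
Qed.

(** Rows n and n + 2 of the factor share only column n + 2, so D merely scales the off-diagonal
    entry by its entry of index n + 2. *)
Lemma entry_hE m n : (m%:R + n.+2%:R - 1) * (m%:R + n.+2%:R) * entry_f m n
  = entry_h m n :> R.
Proof. by rewrite /entry_f /entry_h -!natr1; ring. Qed.

Lemma entry_gE m n : (0 < n)%N ->
  entry_c m n * entry_c m n * ((m%:R + n%:R - 1) * (m%:R + n%:R))
  + entry_d m n * entry_d m n * ((m%:R + n.+2%:R - 1) * (m%:R + n.+2%:R))
  = entry_g m n :> R.
Proof.
case: n => // n _; have m0 : 0 <= m%:R :> R by [].
have n0 : 0 <= n%:R :> R by [].
rewrite -!expr2 sqrrN !sqr_sqrtr -?natr1 ?divr_ge0 ?mulr_ge0 //; try lra.
by rewrite /entry_g -!natr1; field; rewrite !lt0r_neq0 //; lra.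
Qed.

Lemma entry_e_gt0 m n : (0 < n)%N -> 0 < entry_e m n :> R.
Proof.
move=> n0; rewrite -entry_eE // ltr_pwDl -?expr2 ?sqr_ge0 //.
by rewrite exprn_gt0 ?entry_c_gt0.
Qed.

Lemma entry_f_lt0 m n : (0 < n)%N -> entry_f m n < 0 :> R.
Proof. by move=> n0; rewrite -entry_fE // nmulr_rlt0 ?entry_c_gt0 ?entry_d_lt0. Qed.

End CholeskyProducts.

Theorem theoremA1 (R : realType) (m : nat) :
  (exists L : simatrix R, cholesky_factor (mxM m) L) /\
  forall L : simatrix R, cholesky_factor (mxM m) L ->
  [/\ (* 1 *)
      [/\ si_upper_triangular L,
          forall i j : nat, (0 < i)%N -> (0 < j)%N ->
            (L i j != 0 <-> j = i \/ j = (i + 2)%N)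
        & forall n : nat, (0 < n)%N ->
            L n n = entry_c m n /\ L n (n + 2)%N = entry_d m n],
      (* 2 *)
      (let S := simul L (sitr L) in
       [/\ finite_products L (sitr L),
           si_symmetric S,
           forall i j : nat, (0 < i)%N -> (0 < j)%N ->
             (S i j != 0 <-> [\/ j = i, j = (i + 2)%N | i = (j + 2)%N])
         & forall n : nat, (0 < n)%N ->
             [/\ S n n = entry_e m n,
                 S n (n + 2)%N = entry_f m n
               & S (n + 2)%N n = entry_f m n]])
    & (* 3 *)
      (let T := simul (simul L (mxD m)) (sitr L) in
       [/\ finite_products L (mxD m) /\
             finite_products (simul L (mxD m)) (sitr L),
           si_symmetric T,
           forall i j : nat, (0 < i)%N -> (0 < j)%N ->
             T i j != 0 -> [\/ j = i, j = (i + 2)%N | i = (j + 2)%N]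
         & forall n : nat, (0 < n)%N ->
             [/\ T n n = entry_g m n,
                 T n (n + 2)%N = entry_h m n
               & T (n + 2)%N n = entry_h m n]])].
Proof.
split=> [|L LP]; first by exists (cholesky_mx m); exact: cholesky_mxP.
(* By uniqueness, any Cholesky factor has the explicit entries of [cholesky_mx m]. *)
have LE := cholesky_factor_uniq _ _ _ LP (cholesky_mxP m).
have Lup : si_upper_triangular L by case: LP.
have Lc n : (0 < n)%N -> L n n = entry_c m n.
  by move=> n0; rewrite LE // /cholesky_mx eqxx.
have Ld n : (0 < n)%N -> L n n.+2 = entry_d m n.
  by move=> n0; rewrite LE // /cholesky_mx eqxx gtn_eqF.
have Lb : bidiagonal L.
  by move=> i j i0 j0 ji ji2; rewrite LE // /cholesky_mx (negPf ji) (negPf ji2).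
have Dd : diagonal (@mxD R m).
  by move=> i j _ _ ji; rewrite /mxD eq_sym (negPf ji).
have DE n : mxD m n n = (m%:R + n%:R - 1) * (m%:R + n%:R) :> R.
  by rewrite /mxD eqxx.
have LDb := bidiagonal_mul_diagonal _ _ Lb Dd.
have Ssym := si_symmetric_mul_tr L.
have Tsym := si_symmetric_mul_diagonal_tr _ _ Lb Dd.
have Sf n : (0 < n)%N -> simul L (sitr L) n n.+2 = entry_f m n.
  by move=> n0; rewrite simul_tr_superdiagE // Lc // Ld // entry_fE.
have Se n : (0 < n)%N -> simul L (sitr L) n n = entry_e m n.
  by move=> n0; rewrite simul_tr_diagE // Lc // Ld // entry_eE.
have Th n : (0 < n)%N -> simul (simul L (mxD m)) (sitr L) n n.+2 = entry_h m n.
  move=> n0; rewrite simul_tr_superdiagE // simul_bidiagonal_diagonal //.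
  by rewrite Lc // Ld // DE -entry_hE -entry_fE //; ring.
have Tg n : (0 < n)%N -> simul (simul L (mxD m)) (sitr L) n n = entry_g m n.
  move=> n0; rewrite simul_tr_diagE // !simul_bidiagonal_diagonal //.
  by rewrite Lc // Ld // !DE -entry_gE //; ring.
(* Each position lies on one of the three diagonals or meets the hypotheses of [simul_tr_eq0]. *)
have off i j : [\/ j = i, j = (i + 2)%N | i = (j + 2)%N] \/
    [/\ j != i, j != i.+2 & i != j.+2].
  rewrite !addn2; have [->|ji] := eqVneq j i; first by left; constructor 1.
  have [->|ji2] := eqVneq j i.+2; first by left; constructor 2.
  have [->|ij2] := eqVneq i j.+2; first by left; constructor 3.
  by right.
split.
- split=> // [i j i0 j0|n n0]; last by rewrite addn2 Lc // Ld.
  rewrite addn2; split=> [|[->|->]].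
  + have [->|ji] := eqVneq j i; first by left.
    have [->|ji2] := eqVneq j i.+2; first by right.
    by rewrite Lb ?eqxx.
  + by rewrite Lc // lt0r_neq0 // entry_c_gt0.
  + by rewrite Ld // ltr0_neq0 // entry_d_lt0.
- split=> // [|i j i0 j0|n n0].
  + exact: finite_products_bidiagonal.
  + split=> [|[jE|jE|iE]].
    * by case: (off i j) => // -[ji ji2 ij2]; rewrite simul_tr_eq0 ?eqxx.
    * by rewrite jE Se // lt0r_neq0 // entry_e_gt0.
    * by rewrite jE addn2 Sf // ltr0_neq0 // entry_f_lt0.
    * by rewrite Ssym // iE addn2 Sf // ltr0_neq0 // entry_f_lt0.
  + by rewrite addn2 Se // [simul _ _ n.+2 n]Ssym // Sf.
- split=> // [|i j i0 j0|n n0].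
  + by split; exact: finite_products_bidiagonal.
  + by case: (off i j) => // -[ji ji2 ij2]; rewrite simul_tr_eq0 ?eqxx.
  + by rewrite addn2 Tg // [simul _ _ n.+2 n]Tsym // Th.
Qed.
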